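(* Let $\{p_\ell\}_{\ell=1}^{\tilde d}\subset\mathbb P_2(S_d)$ be such that the interior space $\mathbb V$ (of dimension $\tilde d$) satisfies $\mathbb V=\operatorname{span}\{(I-\Pi_{1,\Omega})(p_\ell):\ell=1,\dots,\tilde d\}\subset\mathbb S_2(S_d)$. Define the admissible class $$\mathcal A=\left\{\{\rho_\ell\}_{\ell=1}^{\tilde d}\subset\mathbb S_2(S_d):\ \rho_\ell\in\operatorname{span}\{(I-\Pi_{1,\Omega})(p_\ell)\},\ \|\rho_\ell\|_\Omega=1\ \text{for each }\ell\right\}.$$ Let $$\rho_\ell^\star=\frac{(I-\Pi_{1,\Omega})(p_\ell)}{\|(I-\Pi_{1,\Omega})(p_\ell)\|_\Omega},\quad \ell=1,\dots,\tilde d,$$ and $G^\star=[\langle\rho_\ell^\star,\rho_k^\star\rangle_\Omega]_{k\ell}$. Then $$\sigma_{\min}(G^\star)=\max_{\{\rho_\ell\}_{\ell=1}^{\tilde d}\in\mathcal A}\sigma_{\min}(G),$$ where $G=[\langle\rho_\ell,\rho_k\rangle_\Omega]_{k\ell}$ and $\sigma_{\min}$ denotes the smallest eigenvalue. Moreover, if the projections $\{(I-\Pi_{1,\Omega})(p_\ell)\}_{\ell=1}^{\tilde d}$ are pairwise orthogonal with respect to $\langle\cdot,\cdot\rangle_\Omega$, then $G^\star=I_{\tilde d}$.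
   Context: Let $d\ge2$, let $S_d\subset\mathbb R^d$ be a nondegenerate $d$-simplex, and let $\mathbb P_k(S_d)$ be the space of polynomials on $S_d$ of total degree at most $k$. $\Omega\in L^1(S_d)$ is a probability density, strictly positive a.e. in the interior of $S_d$; $\langle f,g\rangle_\Omega=\int_{S_d}fg\,\Omega\,d\boldsymbol\sigma$, $\|f\|_\Omega^2=\langle f,f\rangle_\Omega$. $\mathbb S_2(S_d)=\{p\in\mathbb P_2(S_d):\langle p,\varphi\rangle_\Omega=0\ \forall\varphi\in\mathbb P_1(S_d)\}$. $\tilde d=(d-2)(d+1)/2$. $\Pi_{1,\Omega}:L^2_\Omega(S_d)\to\mathbb P_1(S_d)$ is the orthogonal projection with respect to $\langle\cdot,\cdot\rangle_\Omega$, and $I$ is the identity. (For $d=2$, $\tilde d=0$ and the statement is void.) *)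

(* Defs.v *)
From HB Require Import structures.
From mathcomp Require Import all_boot all_order all_algebra.
From mathcomp Require Import spectral complex polyrcf.
From mathcomp Require mpoly.
(* The notations of mpoly clash with those of MathComp-Analysis. *)
Export -(notations) mpoly.
From mathcomp Require Export all_classical all_reals all_analysis.

Set Implicit Arguments.
Unset Strict Implicit.
Unset Printing Implicit Defensive.

Import Order.TTheory GRing.Theory Num.Theory.
Import numFieldNormedType.Exports.

Local Open Scope classical_set_scope.
Local Open Scope ring_scope.

(* Row vectors carry the sigma-algebra generated by the coordinates, as is done
   for tuples in MathComp-Analysis. *)
Definition measure_rV_display : measure_display -> measure_display.
Proof. exact. Qed.

Section measurable_rV.
Context {d} {T : measurableType d}.
Variable n : nat.

Let coors : 'I_n -> 'rV[T]_n -> T := fun i x => x ord0 i.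

Let rV_set0 : g_sigma_preimage coors set0.
Proof. exact: sigma_algebra0. Qed.

Let rV_setC A : g_sigma_preimage coors A -> g_sigma_preimage coors (~` A).
Proof. exact: sigma_algebraC. Qed.

Let rV_bigcup (F : _^nat) : (forall i, g_sigma_preimage coors (F i)) ->
  g_sigma_preimage coors (\bigcup_i (F i)).
Proof. exact: sigma_algebra_bigcup. Qed.

HB.instance Definition _ := @isMeasurable.Build (measure_rV_display d)
  'rV[T]_n (g_sigma_preimage coors) rV_set0 rV_setC rV_bigcup.

End measurable_rV.

Lemma measurable_coord d (T : measurableType d) n (i : 'I_n) :
  measurable_fun [set: 'rV[T]_n] (fun x : 'rV[T]_n => x ord0 i).
Proof.
move=> _ Y mY; rewrite setTI; apply: sub_sigma_algebra => /=.
rewrite -bigcup_seq/=; exists i => /=; first by rewrite mem_index_enum.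
by exists Y => //; rewrite setTI.
Qed.

Lemma measurable_fun_rVP d1 d2 (T1 : measurableType d1)
    (T2 : measurableType d2) n (f : T1 -> 'rV[T2]_n) :
  (forall i, measurable_fun [set: T1] (fun x => f x ord0 i)) ->
  measurable_fun [set: T1] f.
Proof.
move=> mf.
suff S : g_sigma_preimage (fun i x => f x ord0 i) `<=` measurable.
  move=> _ A mA; rewrite setTI; apply: S.
  by rewrite (@g_sigma_preimage_comp _ _ _ _ (fun i (y : 'rV[T2]_n) => y ord0 i));
    exists A => //; rewrite setTI.
apply: smallest_sub; first exact: sigma_algebra_measurable.
case: n => [|n] in f mf *; first by rewrite big_ord0.
rewrite -bigcup_mkord_ord; apply: bigcup_sub => i Ii.
by move=> A [B mB <-]; exact: mf.
Qed.

Section lebesgue_rV.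
Context {R : realType}.

Definition rV_cons n (x : measurableTypeR R * 'rV[R]_n) : 'rV[R]_n.+1 :=
  \row_i if unlift ord0 i is Some j then x.2 ord0 j else x.1.

Definition rV_uncons n (x : 'rV[R]_n.+1) : measurableTypeR R * 'rV[R]_n :=
  (x ord0 ord0, \row_i x ord0 (lift ord0 i)).

Lemma rV_consK n : cancel (@rV_cons n) (@rV_uncons n).
Proof.
case=> a x; rewrite /rV_uncons /rV_cons mxE unlift_none; congr (_, _).
by apply/rowP => i; rewrite !mxE liftK.
Qed.

Lemma measurable_rV_cons n : measurable_fun setT (@rV_cons n).
Proof.
apply: measurable_fun_rVP => i; rewrite /rV_cons.
under eq_fun do rewrite mxE.
case: unliftP => [j|] _; last exact: measurable_fst.
exact: (measurableT_comp (measurable_coord _)).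
Qed.

Lemma measurable_rV_uncons n : measurable_fun setT (@rV_uncons n).
Proof.
apply: measurable_fun_pair; first exact: measurable_coord.
apply: measurable_fun_rVP => i; under eq_fun do rewrite mxE.
exact: measurable_coord.
Qed.

Lemma rV_unconsK n : cancel (@rV_uncons n) (@rV_cons n).
Proof.
move=> x; apply/rowP => i; rewrite mxE /=.
by case: unliftP => [j ->|->] //; rewrite mxE.
Qed.

Section lebesgue_rV_step.
Variables (n : nat) (m : {sigma_finite_measure set 'rV[R]_n -> \bar R}).

Definition lebesgue_rV_step : set 'rV[R]_n.+1 -> \bar R :=
  pushforward (lebesgue_measure \x m)%E (@rV_cons n).

Let mcons := @measurable_rV_cons n.

Let step0 : lebesgue_rV_step set0 = 0%E.
Proof. by have := mcons => ?; exact: measure0. Qed.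

Let step_ge0 A : (0 <= lebesgue_rV_step A)%E.
Proof. by have := mcons => ?; exact: measure_ge0. Qed.

Let step_sigma_additive : semi_sigma_additive lebesgue_rV_step.
Proof. by have := mcons => ?; exact: measure_semi_sigma_additive. Qed.

HB.instance Definition _ := isMeasure.Build _ _ _ lebesgue_rV_step
  step0 step_ge0 step_sigma_additive.

Let step_sigma_finite : sigma_finite setT lebesgue_rV_step.
Proof.
have /sigma_finiteP[F [TF ndF Foo]] := sigma_finiteT (@lebesgue_measure R).
have /sigma_finiteP[G [TG ndG Goo]] := sigma_finiteT m.
exists (fun i => @rV_uncons n @^-1` (F i `*` G i)).
  rewrite -preimage_bigcup; apply/esym; rewrite -[RHS](preimage_setT (@rV_uncons n)).
  congr (_ @^-1` _); rewrite -setXTT TF TG predeqE => -[x y]; split.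
    by move=> [i _ []/= ? ?]; split; exists i.
  move=> [/= [i _ Fix] [k _ Gky]]; exists (maxn i k) => //; split.
  - by move: x Fix; exact/subsetPset/ndF/leq_maxl.
  - by move: y Gky; exact/subsetPset/ndG/leq_maxr.
move=> i; have [mF Fi] := Foo i; have [mG Gi] := Goo i; split.
  rewrite -[X in measurable X]setTI.
  by apply: measurable_rV_uncons => //; exact: measurableX.
rewrite /lebesgue_rV_step /pushforward -comp_preimage.
rewrite (_ : _ \o _ = id) ?preimage_id; last by apply/funext => x; exact: rV_consK.
by rewrite product_measure1E// lte_mul_pinfty// ge0_fin_numE.
Qed.

HB.instance Definition _ := Measure_isSigmaFinite.Build _ _ _ lebesgue_rV_step
  step_sigma_finite.

End lebesgue_rV_step.

Fixpoint lebesgue_rV n : {sigma_finite_measure set 'rV[R]_n -> \bar R} :=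
  if n is n'.+1 then lebesgue_rV_step (lebesgue_rV n')
  else \d_ (0 : 'rV[R]_0).

(* Boxes generate the sigma-algebra, hence this characterizes lebesgue_rV. *)
Lemma lebesgue_rV_box n (A : 'I_n -> set (measurableTypeR R)) :
  (forall i, measurable (A i)) ->
  lebesgue_rV n [set x | forall i, A i (x ord0 i)] =
  (\prod_(i < n) lebesgue_measure (A i))%E.
Proof.
elim: n A => [|n IH] A mA.
  by rewrite big_ord0 /= diracE mem_set// => -[].
rewrite big_ord_recl /= -IH//.
have mB : measurable [set x : 'rV[R]_n | forall i, A (lift ord0 i) (x ord0 i)].
  rewrite (_ : mkset _ = \bigcap_(i in [set: 'I_n])
      (fun x : 'rV[R]_n => x ord0 i) @^-1` A (lift ord0 i)); last first.
    by apply/seteqP; split => x /= h i; [move=> _|]; exact: h.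
  apply: fin_bigcap_measurable => // i _; rewrite -[X in measurable X]setTI.
  by apply: (@measurable_coord _ (measurableTypeR R) n i).
rewrite -product_measure1E//; congr (product_measure1 _ _ _).
apply/seteqP; split => -[a x] /=.
  move=> h; split => [|i].
    by have := h ord0; rewrite mxE unlift_none.
  by have := h (lift ord0 i); rewrite mxE liftK.
by case=> h0 h i; rewrite mxE; case: unliftP => [j ->|->] /=; [exact: h|].
Qed.

End lebesgue_rV.

Lemma symmetric_eigenvalue (R : rcfType) n (A : 'M[R]_n) : (0 < n)%N ->
  A^T = A -> exists a, eigenvalue A a.
Proof.
case: n A => // n A _ sA.
pose C := map_mx (real_complex R) A.
have Ch : C \is hermsymmx.
  apply: realsym_hermsym.
    by apply/is_hermitianmxP; rewrite expr0 scale1r map_mx_id// /C map_trmx sA.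
  by apply/mxOverP => i j; rewrite mxE; apply/complex_realP; exists (A i j).
have cr := hermitian_spectral_diag_real Ch.
have /hermitian_normalmx/orthomx_spectralP eC := Ch.
set c := spectral_diag C 0 0.
have c_eig : eigenvalue C c.
  apply/eigenvalueP; exists (row 0 (spectralmx C)).
    rewrite -row_mul {2}eC !mulmxA mulmxV ?spectral_unit// mul1mx.
    by rewrite row_mul row_diag_mx -scalemxAl -rowE.
  apply/eqP => r0.
  have := spectral_unit C; rewrite -row_free_unit -kermx_eq0.
  apply/negP/rowV0Pn; exists (delta_mx 0 0).
    by apply/sub_kermxP; rewrite -rowE.
  by apply/eqP => /rowP/(_ 0)/eqP; rewrite !mxE eqxx oner_eq0.
have cE : c = (complex.Re c)%:C%C by apply/esym/RRe_real; exact: (mxOverP cr).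
exists (complex.Re c).
move: c_eig; rewrite cE !eigenvalue_root_char /C -map_char_poly.
by rewrite fmorph_root.
Qed.

Section linear_algebra.
Context {R : realType}.

Definition lspan (E : lmodType R) (I : finType) (b : I -> E) : set E :=
  [set x | exists c : I -> R, x = \sum_i c i *: b i].

Definition lin_indep (E : lmodType R) (I : finType) (b : I -> E) : Prop :=
  forall c : I -> R, \sum_i c i *: b i = 0 -> forall i, c i = 0.

Definition has_dim (E : lmodType R) (V : set E) (n : nat) : Prop :=
  exists b : 'I_n -> E, lin_indep b /\ V = lspan b.

(* 0 is a default value, never used for a real symmetric matrix of positive size:
   see smallest_eigenvalueP. *)
Definition smallest_eigenvalue n (A : 'M[R]_n) : R :=
  xget 0 [set a | eigenvalue A a /\ forall b, eigenvalue A b -> a <= b].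

Lemma smallest_eigenvalueP n (A : 'M[R]_n) : (0 < n)%N ->
  A^T = A -> eigenvalue A (smallest_eigenvalue A) /\
  (forall b, eigenvalue A b -> smallest_eigenvalue A <= b).
Proof.
move=> n0 /symmetric_eigenvalue -/(_ n0) [a0 Aa0].
suff [a Pa] : exists a, eigenvalue A a /\ forall b, eigenvalue A b -> a <= b.
  exact: (@xgetPex _ 0 [set a | _ /\ _] (ex_intro _ a Pa)).
have p0 := monic_neq0 (char_poly_monic A).
pose s := rootsR (char_poly A).
have sP b : (b \in s) = eigenvalue A b.
  by rewrite eigenvalue_root_char -(roots_on_rootsR p0) ?in_itv.
have sn0 : a0 \in s by rewrite sP.
have [a [sa amin]] : exists a, a \in s /\ forall b, b \in s -> a <= b.
  elim: s a0 sn0 {sP Aa0} => // x s IH _ _.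
  case: s IH => [|y s] IH.
    by exists x; split=> [|b]; rewrite inE// => /eqP->.
  have [a [sa amin]] := IH y (mem_head _ _).
  exists (Num.min x a); split.
    by rewrite minElt; case: ifP; rewrite inE ?eqxx ?sa ?orbT.
  by move=> b; rewrite inE => /predU1P[->|/amin]; rewrite ge_min ?lexx// => ->; rewrite orbT.
by exists a; split=> [|b]; rewrite -sP//; exact: amin.
Qed.

Definition is_max (A : set R) (m : R) : Prop := A m /\ ubound A m.

End linear_algebra.

Section simplex.
Context {R : realType}.
Variables (d : nat) (v : 'I_d.+1 -> 'rV[R]_d).

Definition nondegenerate_simplex : Prop :=
  lin_indep (fun i : 'I_d => v (lift ord0 i) - v ord0).

Definition simplex : set 'rV[R]_d :=
  [set x | exists t : 'I_d.+1 -> R, [/\ forall i, 0 <= t i,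
    \sum_i t i = 1 & x = \sum_i t i *: v i]].

End simplex.

Section weighted.
Context {R : realType}.
Variables (d : nat) (S : set 'rV[R]_d) (Omega : 'rV[R]_d -> R).

(* Omega is a Borel representative of its class in L^1. *)
Definition positive_density : Prop :=
  [/\ (lebesgue_rV d).-integrable S (EFin \o Omega),
      {ae lebesgue_rV d, forall x, S x -> 0 <= Omega x},
      \int[lebesgue_rV d]_(x in S) Omega x = 1
    & {ae lebesgue_rV d, forall x, S° x -> 0 < Omega x}].

Definition inner (f g : 'rV[R]_d -> R) : R :=
  \int[lebesgue_rV d]_(x in S) (f x * g x * Omega x).

(* A polynomial on a set with nonempty interior is determined by its values, so
   the polynomials on the simplex are represented by formal ones. *)
Definition peval (p : mpoly d R) : 'rV[R]_d -> R :=
  fun x => meval (fun i => x ord0 i) p.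

(* msize is 1 + the total degree, and 0 for the zero polynomial. *)
Definition polys (k : nat) : set (mpoly d R) := [set p | (msize p <= k.+1)%N].

Definition pinner (p q : mpoly d R) : R := inner (peval p) (peval q).

Definition pnorm (p : mpoly d R) : R := Num.sqrt (pinner p p).

Definition S2 : set (mpoly d R) :=
  [set p | polys 2 p /\ forall phi, polys 1 phi -> pinner p phi = 0].

(* The orthogonal projection onto the affine polynomials; it is meaningful for
   f square-integrable with respect to Omega on S. *)
Definition Pi1 (f : 'rV[R]_d -> R) : mpoly d R :=
  xget 0 [set r | polys 1 r /\
    forall phi, polys 1 phi -> inner (f \- peval r) (peval phi) = 0].

Definition residual (p : mpoly d R) : mpoly d R := p - Pi1 (peval p).

Definition normalized (p : mpoly d R) : mpoly d R := (pnorm p)^-1 *: p.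

Definition gram n (rho : 'I_n -> mpoly d R) : 'M[R]_n :=
  \matrix_(k, l) pinner (rho l) (rho k).

Definition admissible n (p : 'I_n -> mpoly d R) : set ('I_n -> mpoly d R) :=
  [set rho | forall l, [/\ S2 (rho l),
    lspan (fun _ : unit => residual (p l)) (rho l) & pnorm (rho l) = 1]].

End weighted.

Definition dtilde (d : nat) : nat := ((d - 2) * d.+1)./2.

(* Main.v *)
(* Since span{q_l} has dimension the number of the q_l := (I - Pi_1)(p_l), no q_l
   vanishes, and so <q_l, q_l> > 0: a nonzero polynomial is nonzero on some ball
   inside the simplex, where Omega > 0 almost everywhere.  An admissible rho_l is
   a multiple of q_l of norm 1, hence rho_l = e_l rho*_l with e_l = 1 or -1.
   Every admissible Gram matrix is therefore D G* D with D = diag(e_l), D^2 = 1,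
   and has the same eigenvalues as G*: the maximum is that of a constant. *)
Require Import Defs.
From HB Require Import structures.
From mathcomp Require Import all_boot all_order all_algebra.
From mathcomp Require Import all_classical all_reals all_analysis.
From mathcomp Require Import measurable_realfun ring.
Import Order.TTheory GRing.Theory Num.Theory.
Import numFieldNormedType.Exports.
Local Open Scope classical_set_scope.
Local Open Scope ring_scope.

(** * Nonvanishing of multivariate polynomials near a point *)

(** The lowest digit is the remainder modulo [B], and the quotient is the expansion of the shifted
    digits, to which induction applies. *)
Lemma digit_expansion_inj (B n : nat) (f g : nat -> nat) :
  (forall i, (i < n)%N -> (f i < B)%N) -> (forall i, (i < n)%N -> (g i < B)%N) ->
  (\sum_(i < n) f i * B ^ i = \sum_(i < n) g i * B ^ i)%N ->
  forall i, (i < n)%N -> f i = g i.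
Proof.
elim: n f g => // n IH f g fB gB.
have split (h : nat -> nat) : (\sum_(i < n.+1) h i * B ^ i = (\sum_(i < n) h i.+1 * B ^ i) * B + h 0)%N.
  rewrite big_ord_recl expn0 muln1 addnC big_distrl/=; congr (_ + _)%N.
  by apply: eq_bigr => i _; rewrite expnSr mulnA.
rewrite !split => e.
have f0 := fB 0%N isT; have g0 := gB 0%N isT.
have B0 : (0 < B)%N by exact: leq_ltn_trans f0.
move=> [|i]; first by move/(congr1 (modn^~ B)): e; rewrite !modnMDl !modn_small.
apply: (IH (f \o S) (g \o S)) => // [j|j|]; [exact: (fB j.+1)|exact: (gB j.+1)|].
by move/(congr1 (divn^~ B)): e; rewrite !divnMDl// !divn_small// !addn0.
Qed.

(** The points [e / (i + 2)] with [i < size P] are distinct and lie strictly between 0 and [e]; a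
    nonzero [P] has fewer than [size P] roots. *)
Lemma exists_nonroot_small (R : realType) (P : {poly R}) (e : R) :
  P != 0 -> 0 < e -> exists2 t, 0 < t < e & P.[t] != 0.
Proof.
move=> P0 e0; pose s := [seq e / (i.+2)%:R | i <- iota 0 (size P)].
have us : uniq s.
  rewrite map_inj_uniq ?iota_uniq// => i j /(mulfI (lt0r_neq0 e0)) /invr_inj /eqP.
  by rewrite eqr_nat => /eqP[].
have : ~~ all (root P) s.
  apply/negP => /(max_poly_roots P0)/(_ us).
  by rewrite size_map size_iota ltnn.
move=> /allPn[t /mapP[i _ ->] rt]; exists (e / i.+2%:R) => //.
by rewrite divr_gt0// ltr_pdivrMr// ltr_pMr// ltr1n.
Qed.

(* Along the curve t |-> (c_i + t^(B^i))_i with B > deg p, distinct monomials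
   become monic polynomials of distinct degrees, so they cannot cancel. *)
Lemma mpoly_nonvanishing (R : realType) (n : nat) (p : mpoly n R)
    (c : 'I_n -> R) (e : R) : p != 0 -> 0 < e ->
  exists2 x : 'I_n -> R, (forall i, `|x i - c i| < e) & meval x p != 0.
Proof.
move=> p0 e0; pose B := msize p.
have B0 : (0 < B)%N by rewrite lt0n msize_poly_eq0.
(* The degree in t of the monomial [m] along the curve; its base-[B] digits are the exponents of
   [m]. *)
pose N (m : multinom n) := (\sum_(i < n) m i * B ^ i)%N.
have mB (m : multinom n) i : m \in msupp p -> (m i < B)%N.
  move=> /msize_mdeg_lt; apply: leq_ltn_trans.
  by rewrite mdegE (bigD1 i)//= leq_addr.
have Ninj (m m' : multinom n) : m \in msupp p -> m' \in msupp p -> N m = N m' -> m = m'.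
  move=> mp mp' eN; apply/mnmP => i.
  (* Exponents are extended by 0 to all of [nat], the index type of digit sequences. *)
  pose ext (m : multinom n) k := if insub k is Some j then m j else 0%N.
  have extE m0 (j : 'I_n) : ext m0 j = m0 j by rewrite /ext valK.
  rewrite -!extE; apply: (@digit_expansion_inj B n) => // [k kn|k kn|].
  - by rewrite -[k]/(val (Ordinal kn)) extE mB.
  - by rewrite -[k]/(val (Ordinal kn)) extE mB.
  - by under eq_bigr do rewrite extE; under [RHS]eq_bigr do rewrite extE.
(* The monomial of largest degree along the curve, unique because [N] is injective on the
   support. *)
have [m mp mmax] : exists2 m, m \in msupp p &
    forall m', m' \in msupp p -> m' != m -> (N m' < N m)%N.
  have : msupp p != [::] by rewrite msupp_eq0.
  case E : (msupp p) => [|m0 s] // _; rewrite -E.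
  have exN : exists k, k \in map N (msupp p).
    by exists (N m0); rewrite map_f// E mem_head.
  have bN k : k \in map N (msupp p) -> (k <= \max_(m <- msupp p) N m)%N.
    by move=> /mapP[m1 m1p ->]; exact: leq_bigmax_seq.
  case: (ex_maxnP exN bN) => _ /mapP[m mp ->] mmax; exists m => // m' mp' mm'.
  rewrite ltn_neqAle mmax ?map_f// andbT.
  by apply: contraNN mm' => /eqP/Ninj ->.
pose F (m : multinom n) : {poly R} := \prod_(i < n) ('X^(B ^ i) + (c i)%:P) ^+ m i.
have size_fac (i : 'I_n) : size ('X^(B ^ i) + (c i)%:P) = (B ^ i).+1.
  rewrite size_polyDl size_polyXn// ltnS (leq_trans (size_polyC_leq1 _))//.
  by rewrite expn_gt0 B0.
have mon_fac (i : 'I_n) : 'X^(B ^ i) + (c i)%:P \is monic.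
  rewrite monicE lead_coefDl ?lead_coefXn//.
  rewrite size_polyXn ltnS (leq_trans (size_polyC_leq1 _))//.
  by rewrite expn_gt0 B0.
have Fmon m0 : F m0 \is monic.
  by apply: monic_prod => i _; exact: monic_exp.
have Fsize m0 : size (F m0) = (N m0).+1.
  rewrite size_prod; last by move=> i _; exact/monic_neq0/monic_exp.
  have fac (i : 'I_n) : size (('X^(B ^ i) + (c i)%:P) ^+ m0 i) = (m0 i * B ^ i + 1)%N.
    by rewrite polySpred ?monic_neq0 ?monic_exp// size_exp size_fac/= mulnC addn1.
  under eq_bigr do rewrite fac.
  by rewrite big_split/= sum1_card -addSn addnK.
pose P := \sum_(m <- msupp p) mcoeff m p *: F m.
(* Only [F m] reaches degree [N m], and it is monic. *)
have PN : P`_(N m) = mcoeff m p.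
  rewrite coef_sum (bigD1_seq m)//= big_seq_cond big1 ?addr0.
    by have /monicP := Fmon m; rewrite lead_coefE Fsize/= coefZ => ->; rewrite mulr1.
  move=> m' /andP[mp' mm']; rewrite coefZ nth_default ?mulr0//.
  by rewrite Fsize mmax.
have P0 : P != 0.
  apply/eqP => P0; move: PN; rewrite P0 coef0 => /esym/eqP.
  by rewrite mcoeff_eq0 mp.
(* With [t < 1] and [B ^ i >= 1], every displacement [t ^+ (B ^ i)] is at most [t], hence below
   [e]. *)
have [|t] := @exists_nonroot_small R P (Num.min e 1) P0.
  by rewrite lt_min e0 ltr01.
rewrite lt_min => /and3P[t0 te t1] Pt.
exists (fun i : 'I_n => t ^+ (B ^ i) + c i) => [i|].
  rewrite addrK ger0_norm ?exprn_ge0 ?ltW//; apply: le_lt_trans te.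
  have : (0 < B ^ i)%N by rewrite expn_gt0 B0.
  case: (B ^ i)%N => // k _.
  by rewrite exprS ler_piMr ?(ltW t0)// exprn_ile1// ltW.
congr (_ != _): Pt; rewrite mevalE horner_sum; apply: eq_bigr => m0 _.
rewrite hornerZ horner_prod; congr (_ * _); apply: eq_bigr => i _.
by rewrite !hornerE.
Qed.

(** * Polynomial functions, and the measure of balls *)

Lemma peval_bounded (R : realType) (n : nat) (p : mpoly n R) (A : set 'rV[R]_n)
    (B : R) :
  (forall x, A x -> forall j, `|x ord0 j| <= B) -> [bounded peval p x | x in A].
Proof.
move=> AB; exists (\sum_(m <- msupp p) `|mcoeff m p| * \prod_(i < n) B ^+ m i).
split; first exact: num_real.
move=> M /ltW BM x Ax; apply: le_trans BM; rewrite /peval mevalE.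
apply: le_trans (ler_norm_sum _ _ _) _; apply: ler_sum => m _.
rewrite normrM ler_wpM2l// normr_prod; apply: ler_prod => i _.
by rewrite normr_ge0 normrX lerXn2r ?nnegrE ?normr_ge0 ?AB// (le_trans _ (AB _ Ax i)).
Qed.

Lemma continuous_peval (R : realType) (n : nat) (p : mpoly n R) :
  continuous (peval p : 'rV[R]_n -> R).
Proof.
rewrite /peval; under eq_fun do rewrite mevalE.
apply: (@continuous_big R _ +%R 0 xpredT) => [|m _].
  by move=> z; exact: add_continuous.
move=> x; apply: continuousM; first exact: cst_continuous.
move: x; apply: (@continuous_big R _ *%R 1 xpredT) => [|i _].
  by move=> z; exact: mul_continuous.
move=> x; apply: (@continuous_comp _ _ _ (fun y : 'rV[R]_n => y ord0 i)
  (fun a => a ^+ m i)); [exact: coord_continuous|exact: exprn_continuous].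
Qed.

Lemma measurable_peval (R : realType) (n : nat) (p : mpoly n R) :
  measurable_fun [set: 'rV[R]_n] (peval p).
Proof.
rewrite /peval; under eq_fun do rewrite mevalE.
apply: measurable_sum => m; apply: measurable_funM => //.
apply: measurable_prod => i _; apply: measurable_funX.
exact: (@measurable_coord _ (measurableTypeR R)).
Qed.

(** Balls of row vectors are those of the sup norm, so they are boxes and [lebesgue_rV_box] gives
    their measure. *)
Lemma lebesgue_rV_ball (R : realType) (n : nat) (x : 'rV[R]_n) (e : R) : 0 < e ->
  measurable (ball x e) /\ (0 < lebesgue_rV n (ball x e))%E.
Proof.
move=> e0.
have ballE : ball x e = [set y | forall i, ball (x ord0 i) e (y ord0 i)].
  apply/seteqP; split => y /=; first by move=> [_ h] i; exact: h.
  by move=> h; split => // i j; rewrite ord1.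
have mb i : measurable (ball (x ord0 i) e : set (measurableTypeR R)).
  exact: measurable_ball.
rewrite ballE; split.
  rewrite [X in measurable X](_ : _ = \bigcap_(i in [set: 'I_n])
      (fun y : 'rV[R]_n => y ord0 i) @^-1` ball (x ord0 i) e); last first.
    by apply/seteqP; split => y /= h i; [move=> _|]; exact: h.
  apply: fin_bigcap_measurable => // i _; rewrite -[X in measurable X]setTI.
  exact: (@measurable_coord _ (measurableTypeR R) n i).
rewrite (lebesgue_rV_box mb); elim/big_ind: _ => //= [|i _]; first exact: mule_gt0.
by rewrite lebesgue_measure_ball ?ltW// lte_fin pmulrn_lgt0.
Qed.

(** * Barycentric coordinates and the geometry of the simplex *)

Lemma lin_indep_unitmx (R : realType) (n : nat) (b : 'I_n -> 'rV[R]_n) :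
  lin_indep b -> (\matrix_i b i) \in unitmx.
Proof.
move=> lib; rewrite -row_free_unit -kermx_eq0; apply/rowV0P => u /sub_kermxP uM.
apply/rowP => i; rewrite mxE; apply: (lib (u ord0)).
rewrite -[RHS]uM mulmx_sum_row.
by apply: eq_bigr => j _; rewrite rowK.
Qed.

Definition edge_mx {R : realType} {d : nat} (v : 'I_d.+1 -> 'rV[R]_d) : 'M[R]_d :=
  \matrix_i (v (lift ord0 i) - v ord0).

(* Barycentric coordinates with respect to the vertices other than v ord0. *)
Definition barycoord {R : realType} {d : nat} (v : 'I_d.+1 -> 'rV[R]_d)
    (i : 'I_d) (x : 'rV[R]_d) : R :=
  ((x - v ord0) *m invmx (edge_mx v)) ord0 i.

(** The weight of [v ord0] is eliminated as 1 minus the other weights. *)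
Lemma barycentric_edge (R : realType) (d : nat) (v : 'I_d.+1 -> 'rV[R]_d)
    (t : 'I_d.+1 -> R) : \sum_i t i = 1 ->
  \sum_i t i *: v i = v ord0 + (\row_i t (lift ord0 i)) *m edge_mx v.
Proof.
rewrite !big_ord_recl/= => t1; rewrite mulmx_sum_row.
have -> : t ord0 = 1 - \sum_(i < d) t (lift ord0 i) by rewrite -t1 addrK.
rewrite scalerBl scale1r -addrA; congr (_ + _).
rewrite addrC scaler_suml -sumrB; apply: eq_bigr => i _.
by rewrite rowK mxE scalerBr.
Qed.

(** Replaces the existential over weights by finitely many inequalities between polynomial
    functions, from which measurability and interior points can be read off. *)
Lemma simplexE (R : realType) (d : nat) (v : 'I_d.+1 -> 'rV[R]_d) :
  nondegenerate_simplex v ->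
  simplex v = [set x | (forall i, 0 <= barycoord v i x) /\
                       \sum_i barycoord v i x <= 1].
Proof.
move=> /lin_indep_unitmx Mu; apply/seteqP; split => [x [t [t0 t1 ->]]|x [b0 b1]].
  have bE i : barycoord v i (\sum_i t i *: v i) = t (lift ord0 i).
    by rewrite /barycoord barycentric_edge// addrC addKr mulmxK// mxE.
  split=> [i|]; first by rewrite bE.
  under eq_bigr do rewrite bE.
  by rewrite -t1 big_ord_recl lerDr.
(* The weight left over for [v ord0] is whatever brings the total to 1. *)
pose t i := if unlift ord0 i is Some j then barycoord v j x
            else 1 - \sum_i barycoord v i x.
have tE j : t (lift ord0 j) = barycoord v j x by rewrite /t liftK.
have t1 : \sum_i t i = 1.
  rewrite big_ord_recl; under eq_bigr do rewrite tE.
  by rewrite /t unlift_none subrK.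
exists t; split=> // [i|].
  by rewrite /t; case: unlift => [j|] //; rewrite subr_ge0.
rewrite barycentric_edge//.
rewrite (_ : \row_i _ = (x - v ord0) *m invmx (edge_mx v)) ?mulmxKV ?subrKC//.
by apply/rowP => i; rewrite !mxE tE /barycoord mxE.
Qed.

Lemma barycoordE (R : realType) (d : nat) (v : 'I_d.+1 -> 'rV[R]_d) i :
  exists p : mpoly d R, barycoord v i = peval p.
Proof.
exists (\sum_j (mpolyX R (mnm1 j) - mpolyC d (v ord0 ord0 j)) *
   mpolyC d (invmx (edge_mx v) j i)).
apply/funext => x; rewrite /peval/barycoord mxE.
rewrite (big_morph _ (@mevalD _ _ _) (@meval0 _ _ _)); apply: eq_bigr => j _.
by rewrite mevalM mevalB mevalXU !mevalC !mxE.
Qed.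

Lemma measurable_simplex (R : realType) (d : nat) (v : 'I_d.+1 -> 'rV[R]_d) :
  nondegenerate_simplex v -> measurable (simplex v).
Proof.
move=> hv; rewrite simplexE//.
have mb i : measurable_fun setT (barycoord v i).
  by have [p ->] := @barycoordE R d v i; exact: measurable_peval.
apply: measurableI; last first.
  rewrite -[X in measurable X]setTI.
  by apply: measurable_fun_le => //; exact: measurable_sum.
rewrite [X in measurable X](_ : _ = \bigcap_(i in [set: 'I_d])
    [set x | 0 <= barycoord v i x]); last first.
  by apply/seteqP; split => x /= h i; [move=> _|]; exact: h.
apply: fin_bigcap_measurable => // i _; rewrite -[X in measurable X]setTI.
exact: measurable_fun_le.
Qed.

Lemma simplex_bounded (R : realType) (d : nat) (v : 'I_d.+1 -> 'rV[R]_d) x j :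
  simplex v x -> `|x ord0 j| <= \sum_i \sum_k `|v i ord0 k|.
Proof.
move=> [t [t0 t1 ->]]; rewrite summxE.
apply: le_trans (ler_norm_sum _ _ _) _; apply: ler_sum => i _.
rewrite mxE normrM ger0_norm//.
have t_le1 : t i <= 1 by rewrite -t1 (bigD1 i)//= lerDl sumr_ge0.
apply: le_trans (ler_wpM2r (normr_ge0 _) t_le1) _; rewrite mul1r.
by rewrite (bigD1 j)//= lerDl sumr_ge0.
Qed.

(** At the centroid all the inequalities of [simplexE] are strict, and by continuity they persist
    nearby. *)
Lemma simplex_interior_nonempty (R : realType) (d : nat) (v : 'I_d.+1 -> 'rV[R]_d) :
  nondegenerate_simplex v -> exists x, (simplex v)° x.
Proof.
move=> hv; have Mu := @lin_indep_unitmx R d _ hv.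
pose x0 := v ord0 + const_mx (d.+1%:R^-1) *m edge_mx v.
have bx0 i : barycoord v i x0 = d.+1%:R^-1.
  by rewrite /barycoord /x0 addrC addKr mulmxK// mxE.
have cb i : continuous (barycoord v i).
  by have [p ->] := @barycoordE R d v i; exact: continuous_peval.
exists x0; rewrite simplexE//; apply: (@filterI _ (nbhs x0)).
  apply: (filter_forall (nbhs_filter x0)) => i.
  have := cb i x0; rewrite /continuous_at bx0 => /cvgr_gt /(_ 0).
  rewrite invr_gt0 ltr0n => /(_ isT); apply: filterS => x; exact: ltW.
have : continuous (fun x => \sum_i barycoord v i x).
  apply: (@continuous_big R _ +%R 0 xpredT) => [|i _]; last exact: cb.
  by move=> z; exact: add_continuous.
move=> /(_ x0); rewrite /continuous_at.
under eq_bigr do rewrite bx0.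
(* The coordinates of the centroid sum to [d / (d + 1) < 1]. *)
rewrite sumr_const card_ord => /cvgr_lt /(_ 1).
rewrite -[_ *+ d]mulr_natl ltr_pdivrMr ?mul1r ?ltr_nat ?ltr0n// => /(_ (ltnSn d)).
by apply: filterS => x; exact: ltW.
Qed.

(** * The weighted inner product on polynomials *)

(** The product [p * q] is bounded on the bounded simplex, and a bounded measurable function times
    the integrable [Omega] is integrable. *)
Lemma pinner_integrable (R : realType) (d : nat) (v : 'I_d.+1 -> 'rV[R]_d)
    (Omega : 'rV[R]_d -> R) (p q : mpoly d R) :
  nondegenerate_simplex v -> positive_density (simplex v) Omega ->
  (lebesgue_rV d).-integrable (simplex v)
    (EFin \o (fun x => peval p x * peval q x * Omega x)).
Proof.
move=> hv [iO _ _ _].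
have mS := @measurable_simplex R d v hv.
have mpq : measurable_fun (simplex v) (peval (p * q)).
  by apply: measurable_funTS; exact: measurable_peval.
have bpq : [bounded peval (p * q) x | x in simplex v].
  by apply: peval_bounded => x Sx j; exact: (@simplex_bounded R d v).
rewrite [X in integrable _ _ X](_ : _ =
    (EFin \o peval (p * q)%R) \* (EFin \o Omega))%E; first exact: integrableMr.
by apply/funext => x /=; rewrite /peval mevalM EFinM.
Qed.

Lemma pinnerC (R : realType) (d : nat) (S : set 'rV[R]_d)
    (Omega : 'rV[R]_d -> R) (p q : mpoly d R) :
  pinner S Omega p q = pinner S Omega q p.
Proof. by rewrite /pinner /inner; under eq_fun do rewrite [X in X * _]mulrC. Qed.

Lemma pinnerZl (R : realType) (d : nat) (v : 'I_d.+1 -> 'rV[R]_d)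
    (Omega : 'rV[R]_d -> R) (c : R) (p q : mpoly d R) :
  nondegenerate_simplex v -> positive_density (simplex v) Omega ->
  pinner (simplex v) Omega (c *: p) q = c * pinner (simplex v) Omega p q.
Proof.
move=> hv hO; rewrite /pinner /inner.
rewrite -RintegralZl; [|exact: measurable_simplex|exact: pinner_integrable].
by apply: eq_Rintegral => x _; rewrite /peval mevalZ -!mulrA.
Qed.

Lemma pinnerZr (R : realType) (d : nat) (v : 'I_d.+1 -> 'rV[R]_d)
    (Omega : 'rV[R]_d -> R) (c : R) (p q : mpoly d R) :
  nondegenerate_simplex v -> positive_density (simplex v) Omega ->
  pinner (simplex v) Omega p (c *: q) = c * pinner (simplex v) Omega p q.
Proof. by move=> hv hO; rewrite pinnerC pinnerZl// pinnerC. Qed.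

(** A vanishing integral of an a.e. nonnegative function forces it to be null a.e.; here this would
    make a ball of positive measure negligible. *)
Lemma pinner_gt0 (R : realType) (d : nat) (v : 'I_d.+1 -> 'rV[R]_d)
    (Omega : 'rV[R]_d -> R) (p : mpoly d R) :
  nondegenerate_simplex v -> positive_density (simplex v) Omega -> p != 0 ->
  0 < pinner (simplex v) Omega p p.
Proof.
move=> hv hO p0; have mS := @measurable_simplex R d v hv.
have ipp := @pinner_integrable R d v Omega p p hv hO.
case: hO => _ Oge0 _ Ogt0.
set f := fun x => peval p x * peval p x * Omega x in ipp *.
have mf := measurable_int _ ipp.
have f_ge0 : {ae lebesgue_rV d, forall x, simplex v x -> 0 <= f x}.
  apply: filterS Oge0 => x O0 Sx.
  by rewrite mulr_ge0 ?O0// -expr2 sqr_ge0.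
(* Nonnegativity holds only a.e., so the integrand is exchanged for its absolute value. *)
have normf : (\int[lebesgue_rV d]_(x in simplex v) (EFin \o f) x =
              \int[lebesgue_rV d]_(x in simplex v) `|(EFin \o f) x|)%E.
  apply: ae_eq_integral => //; first exact: measurableT_comp.
  by apply: filterS f_ge0 => x f0 Sx; rewrite /= ger0_norm ?f0.
have int_neq0 : (\int[lebesgue_rV d]_(x in simplex v) (EFin \o f) x != 0)%E.
  apply/eqP; rewrite normf => /(ae_eq_integral_abs _ mS mf) f_eq0.
  have [x0 Sx0] := @simplex_interior_nonempty R d v hv.
  have /nbhs_ballP[e e0 eS] : nbhs x0 (simplex v)° by exact: nbhs_interior.
  (* A point where [p] does not vanish, chosen close enough to the interior point [x0] to be
     interior as well. *)
  have [y xy py] := @mpoly_nonvanishing R d p (fun i => x0 ord0 i) e p0 e0.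
  have Sy : (simplex v)° (\row_i y i).
    by apply: eS; split => // i j; rewrite ord1 mxE /ball/= distrC.
  have py' : peval p (\row_i y i) != 0.
    by congr (_ != _): py; apply: meval_eq => i; rewrite mxE.
  have : \forall x \near \row_i y i, (simplex v)° x /\ peval p x != 0.
    apply: (@filterI _ (nbhs _)); first exact: nbhs_interior.
    exact: (cvgr_neq0 _ (@continuous_peval R d p _) py').
  move=> /nbhs_ballP[r r0 rS].
  have [mB] := @lebesgue_rV_ball R d (\row_i y i) r r0.
  suff : (lebesgue_rV d).-negligible (ball (\row_i y i) r).
    by move=> /(measure_negligible mB) ->; rewrite ltxx.
  have : {ae lebesgue_rV d, forall x, ~ ball (\row_i y i) r x}.
    (* On the ball both factors [peval p x] and [Omega x] would be nonzero at almost every point,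
       while their product is 0. *)
    apply: filterS2 f_eq0 Ogt0 => x fx0 Ox /rS[Sx px].
    have /fx0 /= /eqP : simplex v x by exact: interior_subset.
    by rewrite eqe !mulf_eq0 orbb (negbTE px)/= gt_eqF ?Ox.
  by move=> [A [mA A0 BA]]; exists A; split=> // x Bx; apply: BA => /(_ Bx).
rewrite lt_neqAle; apply/andP; split.
  (* Since [fine] also sends infinite values to 0, integrability is needed to pass from the real
     integral back to the extended one. *)
  apply: contraNN int_neq0 => /eqP f0.
  by rewrite -[eqbLHS]fineK ?integrable_fin_num//; apply/eqP; congr EFin.
apply: fine_ge0; rewrite [leRHS]normf; exact: integral_ge0.
Qed.

(** * Spanning families, and eigenvalues under sign changes *)

Lemma mem_lspan (R : realType) (E : lmodType R) (I : finType) (b : I -> E) i :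
  lspan b (b i).
Proof.
exists (fun j => (j == i)%:R); rewrite (bigD1 i)//= eqxx scale1r big1 ?addr0//.
by move=> j /negbTE ->; rewrite scale0r.
Qed.

Lemma lspan1E (R : realType) (E : lmodType R) (x : E) :
  lspan (fun _ : unit => x) = [set c *: x | c in setT].
Proof.
have sumE (c : unit -> R) : \sum_i c i *: x = c tt *: x.
  by rewrite (bigD1 tt)//= big1 ?addr0// => -[].
apply/seteqP; split=> [_ [c ->]|_ [c _ <-]]; first by exists (c tt).
by exists (fun=> c); rewrite sumE.
Qed.

(** Expressing a basis [b] through [q] and [q] through [b] gives square matrices with
    [MC *m MD = 1]; a zero [q l] would give [MD] a zero row. *)
Lemma spanning_family_neq0 (R : realType) (E : lmodType R) (n : nat) (V : set E)
    (q : 'I_n -> E) :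
  has_dim V n -> V = lspan q -> forall l, q l != 0.
Proof.
move=> [b [bfree Vb]] Vq l.
have /choice[C bC] : forall i, exists c : 'I_n -> R, b i = \sum_j c j *: q j.
  by move=> i; have := @mem_lspan R E _ b i; rewrite -Vb Vq.
have /choice[D qD] : forall i, exists c : 'I_n -> R, q i = \sum_j c j *: b j.
  by move=> i; have := @mem_lspan R E _ q i; rewrite -Vq Vb.
pose MC := \matrix_(i, j) C i j; pose MD := \matrix_(i, j) D i j.
have CD1 : MC *m MD = 1%:M.
  apply/matrixP => i k; apply/eqP; rewrite -subr_eq0; apply/eqP.
  (* Freeness of [b] allows coefficients to be compared in [b i = \sum_k (MC *m MD) i k *: b k]. *)
  apply: (bfree (fun k => (MC *m MD) i k - 1%:M i k)).
  under eq_bigr do rewrite scalerBl.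
  have -> : \sum_k ((MC *m MD) i k *: b k - 1%:M i k *: b k) =
      \sum_k (MC *m MD) i k *: b k - b i.
    rewrite sumrB; congr (_ - _); rewrite (bigD1 i)//= mxE eqxx scale1r.
    by rewrite big1 ?addr0// => j ji; rewrite mxE eq_sym (negbTE ji) scale0r.
  rewrite (bC i); apply/eqP; rewrite subr_eq0; apply/eqP.
  under [RHS]eq_bigr do rewrite qD scaler_sumr.
  rewrite exchange_big; apply: eq_bigr => j _; rewrite mxE scaler_suml.
  by apply: eq_bigr => k0 _; rewrite !mxE scalerA.
apply/eqP => ql0.
have Dl0 k : D l k = 0 by apply: bfree; rewrite -qD.
(* Both families have size [n], so the one-sided inverse is two-sided: entry [(l, l)] of [MD *m MC]
   is 1, yet row [l] of [MD] is 0. *)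
have /matrixP/(_ l l) := mulmx1C CD1; rewrite !mxE eqxx big1 => [/esym/eqP|k _].
  by rewrite oner_eq0.
by rewrite !mxE Dl0 mul0r.
Qed.

(** [B] is [A] conjugated by the involution [diag(e)], so both have the same eigenvalue predicate.
    The [xget] choices then agree, including in the case of the default value. *)
Lemma smallest_eigenvalue_sign_conj (R : realType) (n : nat) (A B : 'M[R]_n)
    (e : 'I_n -> R) :
  (forall i, e i * e i = 1) -> (forall i j, B i j = e i * e j * A i j) ->
  smallest_eigenvalue B = smallest_eigenvalue A.
Proof.
move=> e1 BA.
have eigen_conj (A' B' : 'M[R]_n) a : (forall i j, B' i j = e i * e j * A' i j) ->
    eigenvalue A' a -> eigenvalue B' a.
  move=> BA' /eigenvalueP[u uA u0]; apply/eigenvalueP.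
  (* The eigenvector is carried over by the sign matrix: [u] becomes [u *m diag(e)]. *)
  exists (\row_i (u ord0 i * e i)).
    apply/rowP => j; have /rowP/(_ j) := uA; rewrite !mxE mulrA => <-.
    rewrite mulr_suml; apply: eq_bigr => i _; rewrite mxE BA'.
    have -> : u ord0 i * e i * (e i * e j * A' i j) =
        (e i * e i) * (u ord0 i * A' i j * e j) by ring.
    by rewrite e1 mul1r.
  apply: contra_neq u0 => /rowP ue0; apply/rowP => i; have := ue0 i.
  rewrite !mxE => /(congr1 ( *%R^~ (e i))).
  by rewrite -mulrA e1 mulr1 mul0r.
rewrite /smallest_eigenvalue; suff -> : eigenvalue B = eigenvalue A by [].
apply/funext => a; apply/idP/idP; apply: eigen_conj => // i j.
by rewrite BA mulrA mulrACA !e1 !mul1r.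
Qed.

(** * Normalization and the maximum over the admissible class *)

Lemma pnormZ (R : realType) (d : nat) (v : 'I_d.+1 -> 'rV[R]_d)
    (Omega : 'rV[R]_d -> R) (c : R) (p : mpoly d R) :
  nondegenerate_simplex v -> positive_density (simplex v) Omega ->
  pnorm (simplex v) Omega (c *: p) = `|c| * pnorm (simplex v) Omega p.
Proof.
move=> hv hO; rewrite /pnorm pinnerZl// pinnerZr// mulrA -expr2.
by rewrite sqrtrM ?sqr_ge0// sqrtr_sqr.
Qed.

Lemma S2Z (R : realType) (d : nat) (v : 'I_d.+1 -> 'rV[R]_d)
    (Omega : 'rV[R]_d -> R) (c : R) (p : mpoly d R) :
  nondegenerate_simplex v -> positive_density (simplex v) Omega ->
  S2 (simplex v) Omega p -> S2 (simplex v) Omega (c *: p).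
Proof.
move=> hv hO [p2 p0]; split=> [|phi phi1].
  exact: leq_trans (msizeZ_le _ _) p2.
by rewrite pinnerZl// p0// mulr0.
Qed.

Theorem theorem7 (R : realType) (d : nat) (hd : (2 <= d)%N)
  (v : 'I_d.+1 -> 'rV[R]_d) (hv : nondegenerate_simplex v)
  (Omega : 'rV[R]_d -> R) (hOmega : positive_density (simplex v) Omega)
  (p : 'I_(dtilde d) -> mpoly d R) (hp : forall l, polys 2 (p l))
  (V : set (mpoly d R)) (hdim : has_dim V (dtilde d))
  (hV : V = lspan (fun l => residual (simplex v) Omega (p l)))
  (hVS : V `<=` S2 (simplex v) Omega) :
  let q := fun l => residual (simplex v) Omega (p l) in
  let rho_star := fun l => normalized (simplex v) Omega (q l) in
  let G := @gram R d (simplex v) Omega (dtilde d) in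
  is_max [set smallest_eigenvalue (G rho) |
            rho in admissible (simplex v) Omega p]
         (smallest_eigenvalue (G rho_star))
  /\ ((forall l k, l != k -> pinner (simplex v) Omega (q l) (q k) = 0) ->
      G rho_star = 1%:M).
Proof.
move=> q rho_star G.
have q_neq0 := @spanning_family_neq0 R _ _ V q hdim hV.
have qq_gt0 l := @pinner_gt0 R d v Omega _ hv hOmega (q_neq0 l).
have norm_gt0 l : 0 < pnorm (simplex v) Omega (q l) by rewrite sqrtr_gt0.
have q_S2 l : S2 (simplex v) Omega (q l).
  by apply: hVS; rewrite hV; exact: mem_lspan.
have rho_star_adm : admissible (simplex v) Omega p rho_star.
  move=> l; split; first exact: S2Z.
    by rewrite lspan1E; exists (pnorm (simplex v) Omega (q l))^-1.
  by rewrite pnormZ// gtr0_norm ?invr_gt0// mulVf// gt_eqF.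
split; [split|].
- by exists rho_star.
- move=> _ [rho rho_adm <-].
  have /choice[e rhoE] : forall l, exists e, e * e = 1 /\ rho l = e *: rho_star l.
    move=> l; have [_] := rho_adm l; rewrite lspan1E -/(q l) => -[c _ <-] norm1.
    (* From [rho l = c *: q l] the factor in front of [rho_star l] is [c] times the norm of [q l];
       its absolute value is the norm of [rho l], that is 1. *)
    exists (c * pnorm (simplex v) Omega (q l)); split; last first.
      by rewrite scalerA mulfK// gt_eqF.
    move: norm1; rewrite pnormZ// => norm1.
    rewrite -expr2 -real_normK ?num_real// normrM (gtr0_norm (norm_gt0 l)) norm1.
    by rewrite expr1n.
  (* The upper bound is attained by every admissible family, so equality is proved. *)
  rewrite le_eqVlt; apply/orP; left; apply/eqP.
  apply: (@smallest_eigenvalue_sign_conj R _ _ _ e) => [i|i j].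
    by have [] := rhoE i.
  rewrite !mxE; have [_ ->] := rhoE i; have [_ ->] := rhoE j.
  by rewrite pinnerZl// pinnerZr// mulrA (mulrC (e j)).
- move=> q_orth; apply/matrixP => k l; rewrite !mxE.
  rewrite pinnerZl// pinnerZr//; have [->|kl] := eqVneq k l.
    (* On the diagonal, the inner product is the squared norm, which cancels the two normalizing
       factors. *)
    rewrite -[pinner _ _ _ _]sqr_sqrtr ?ltW// -/(pnorm _ _ _) expr2.
    by rewrite mulKf ?mulVf// gt_eqF.
  have lk : l != k by rewrite eq_sym.
  by rewrite (q_orth l k lk) [X in _ * X]mulr0 mulr0.
Qed.
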